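(* Let $r\ge 1$ and $k\ge 1$ be integers, let $n=2^k$, and let $V_1,\dots,V_n$ be finite-dimensional vector spaces over a field $K$ with $\dim V_i\ge r$ for all $i$. Then, for the standard (left to right) ordering of the leaves of both the perfect binary tree and the train track tree, $$HF(r,k)\subseteq TT\bigl(r^{\lceil k/2\rceil},2^k\bigr)$$ as subsets of $V_1\otimes\dots\otimes V_n$.
   Context: All trees are finite rooted full binary trees: each vertex has either exactly two children (a node) or no children (a leaf). For a vertex $v$, $\downarrow v$ denotes the set of leaves that are descendants of $v$ (if $v$ is a leaf, $\downarrow v=\{v\}$). Tensor network states: let $\mathfrak T$ be such a tree whose leaves are labelled bijectively by $\{1,\dots,n\}$, and let $f$ be a function from the vertices of $\mathfrak T$ to the non-negative integers. $TNS_{\mathfrak T,f}\subset V_1\otimes\dots\otimes V_n$ is the set of tensors $t$ for which there exist linear subspaces $U_v$ with $\dim U_v\le f(v)$, one for each vertex $v$, such that: $U_v\subset V_i$ if $v$ is the leaf labelled $i$; $U_v\subset U_{v_1}\otimes U_{v_2}$ if $v$ is a node with children $v_1,v_2$; and $t\in U_{\mathfrak r}$ for the root $\mathfrak r$. (Tensor factors are rearranged according to their labels.) For an integer $r$, $TNS_{\mathfrak T,r}$ means $TNS_{\mathfrak T,f}$ with $f$ constant equal to $r$. Perfect binary tree of depth $k$ with the standard left-to-right labelling: the full binary tree with $2^k$ leaves in which every leaf has exactly $k$ ancestors, labelled so that the sets $\downarrow v$ are exactly the sets $\{2^m(i-1)+1,\dots,2^m i\}$ for $0\le m\le k$, $1\le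 i\le 2^{k-m}$. $HF(r,k)$ denotes $TNS_{\mathfrak T,r}$ for this labelled tree. Train track tree with $n$ leaves: the full binary tree with $n$ leaves in which each node has at least one leaf as a child. With the standard left-to-right labelling, the sets $\downarrow v$ are exactly the singletons $\{j\}$, $1\le j\le n$, and the sets $\{1,\dots,j\}$, $2\le j\le n$. $TT(s,n)$ denotes $TNS_{\mathfrak T,s}$ for this labelled tree. *)

(* Defs.v *)
From HB Require Import structures.
From mathcomp Require Import all_boot all_algebra.
From mathcomp Require Import zify.

Set Implicit Arguments.
Unset Strict Implicit.
Unset Printing Implicit Defensive.

Import GRing.Theory.
Local Open Scope ring_scope.

(* Rooted full binary trees with leaves labelled in L. *)
Inductive tree (L : Type) : Type :=
| Leaf of L
| Node of tree L & tree L.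

(* The vertices of T, each represented by the subtree rooted at it; this is
   faithful when the labels of the leaves are pairwise distinct, the only case
   in which tensor network states are considered. *)
Fixpoint vertex (L : Type) (T v : tree L) {struct T} : Prop :=
  v = T \/ (if T is Node T1 T2 then vertex T1 v \/ vertex T2 v else False).

Fixpoint labels (L : Type) (T : tree L) : seq L :=
  match T with
  | Leaf i => [:: i]
  | Node T1 T2 => labels T1 ++ labels T2
  end.

Definition bij_labelled (I : finType) (T : tree I) : Prop :=
  perm_eq (labels T) (enum I).

Fixpoint down (I : finType) (v : tree I) : {set I} :=
  match v with
  | Leaf i => [set i]
  | Node v1 v2 => down v1 :|: down v2
  end.

(* Multi-indices of the basis of the tensor product of the V i formed by the
   pure tensors of vectors of the bases vbasis {:V i}. *)
Definition midx (K : fieldType) (I : finType) (V : I -> vectType K) :=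
  {dffun forall i : I, 'I_(\dim {:V i})}.

(* The tensor product of a finite family of finite-dimensional spaces, in
   coordinates with respect to that basis; see pure and tensor_pureE. *)
Definition tensor (K : fieldType) (I : finType) (V : I -> vectType K)
  : vectType K := {ffun midx V -> K^o}.

Definition pure (K : fieldType) (I : finType) (V : I -> vectType K)
    (a : forall i, V i) : tensor V :=
  [ffun x : midx V => \prod_i coord (vbasis {:V i}) (x i) (a i)].

(* The subfamily of V indexed by S: tensor (V|_S) is the product over S only,
   so that tensor (V|_[set i]) is a copy of V i. *)
Definition subfam (K : fieldType) (I : finType) (V : I -> vectType K)
    (S : {set I}) : {i | i \in S} -> vectType K :=
  fun i => V (val i).

Notation "V |_ S" := (@subfam _ _ V S) (at level 20, S at level 2).

Definition incl (I : finType) (A B : {set I}) (sAB : A \subset B)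
    (i : {i | i \in A}) : {i | i \in B} :=
  exist _ (val i) (subsetP sAB _ (valP i)).

Definition midx_sub (K : fieldType) (I : finType) (V : I -> vectType K)
    (A B : {set I}) (sAB : A \subset B) (x : midx (V|_B)) : midx (V|_A) :=
  [ffun i => x (incl sAB i)].

Definition midx_res (K : fieldType) (I : finType) (V : I -> vectType K)
    (S : {set I}) (x : midx V) : midx (V|_S) :=
  [ffun i => x (val i)].

(* The product of tensors with disjoint sets of factors, with the factors
   rearranged according to their labels. *)
Definition tmul (K : fieldType) (I : finType) (V : I -> vectType K)
    (A B : {set I}) (s : tensor (V|_A)) (t : tensor (V|_B))
    : tensor (V|_(A :|: B)) :=
  [ffun x => s (midx_sub (subsetUl A B) x) * t (midx_sub (subsetUr A B) x)].

Definition tmulv (K : fieldType) (I : finType) (V : I -> vectType K)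
    (A B : {set I}) (U : {vspace tensor (V|_A)}) (W : {vspace tensor (V|_B)})
    : {vspace tensor (V|_(A :|: B))} :=
  <<[seq tmul u w | u <- vbasis U, w <- vbasis W]>>%VS.

(* For S = [set: I], the canonical isomorphism from tensor (V|_S) to
   tensor V. *)
Definition tensor_full (K : fieldType) (I : finType) (V : I -> vectType K)
    (S : {set I}) (s : tensor (V|_S)) : tensor V :=
  [ffun x => s (midx_res S x)].

(* Meaningful when bij_labelled T. The condition at the leaf labelled i, that
   U (Leaf i) be a subspace of V i, is enforced by the type of U. *)
Definition TNS (K : fieldType) (I : finType) (V : I -> vectType K)
    (T : tree I) (f : tree I -> nat) (t : tensor V) : Prop :=
  exists U : forall v : tree I, {vspace tensor (V|_(down v))},
    [/\ forall v, vertex T v -> (\dim (U v) <= f v)%N,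
        forall v1 v2, vertex T (Node v1 v2) ->
          (U (Node v1 v2) <= tmulv (U v1) (U v2))%VS
      & exists2 u, u \in U T & t = tensor_full u].

(* The perfect tree of depth k with leaves lab m, ..., lab (m + 2 ^ k - 1). *)
Fixpoint perfect (L : Type) (lab : nat -> L) (k m : nat) : tree L :=
  if k is k'.+1 then
    Node (perfect lab k' m) (perfect lab k' (m + 2 ^ k'))
  else Leaf (lab m).

(* The train track tree with leaves lab 0, ..., lab j. *)
Fixpoint train_track (L : Type) (lab : nat -> L) (j : nat) : tree L :=
  if j is j'.+1 then Node (train_track lab j') (Leaf (lab j))
  else Leaf (lab 0%N).

(* The m-th label, counted from 0; the reduction modulo n is only there to
   make the function total. *)
Definition ordlab (n : nat) (n_gt0 : (0 < n)%N) (m : nat) : 'I_n :=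
  Ordinal (ltn_pmod m n_gt0).

Lemma pow2_gt0 (k : nat) : (0 < 2 ^ k)%N.
Proof. by rewrite expn_gt0. Qed.

Definition perfect_tree (k : nat) : tree 'I_(2 ^ k) :=
  perfect (ordlab (pow2_gt0 k)) k 0.

Definition train_track_tree (n : nat) (n_gt0 : (0 < n)%N) : tree 'I_n :=
  train_track (ordlab n_gt0) n.-1.

Definition HF (K : fieldType) (r k : nat) (V : 'I_(2 ^ k) -> vectType K)
  : tensor V -> Prop := TNS (perfect_tree k) (fun=> r).
Arguments HF {K} r k {V} t.

Definition TT (K : fieldType) (s n : nat) (n_gt0 : (0 < n)%N)
    (V : 'I_n -> vectType K)
  : tensor V -> Prop := TNS (train_track_tree n_gt0) (fun=> s).
Arguments TT {K} s n n_gt0 {V} t.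

Lemma tensor_pureE (K : fieldType) (I : finType) (V : I -> vectType K)
    (t : tensor V) :
  t = \sum_(x : midx V) t x *: pure (fun i => (vbasis {:V i})`_(x i)).
Proof.
apply/ffunP => y; rewrite sum_ffunE (bigD1 y) //= big1 ?addr0 => [|x neq_xy].
  rewrite !ffunE big1 => [|i _]; first by rewrite [RHS]mulr1.
  by rewrite coord_free ?eqxx // (basis_free (vbasisP _)).
rewrite !ffunE; have [i neq_i] : exists i, x i != y i.
  apply/existsP; apply: contraR neq_xy => /existsPn eq_xy.
  by apply/eqP/ffunP => i; apply/eqP; have := eq_xy i; rewrite negbK.
rewrite (bigD1 i) //= coord_free ?(basis_free (vbasisP _)) //.
by rewrite (negbTE neq_i) mul0r; exact: mulr0.
Qed.

Lemma tmul_pure (K : fieldType) (I : finType) (V : I -> vectType K)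
    (A B : {set I}) (a : forall i, V i) : [disjoint A & B] ->
  tmul (pure (fun i => a (val i)) : tensor (V|_A))
       (pure (fun i => a (val i)) : tensor (V|_B))
  = pure (fun i => a (val i)) :> tensor (V|_(A :|: B)).
Proof.
move=> disAB; apply/ffunP => x; rewrite !ffunE.
pose G (j : {i | i \in A :|: B}) : K :=
  coord (vbasis {:V (val j)}) (x j) (a (val j)).
pose F i := oapp G 1 (insub i).
have FE j : F (val j) = G j by rewrite /F valK.
have FS (S : {set I}) (sS : S \subset A :|: B) :
    \prod_(i : {i | i \in S})
      coord (vbasis {:V (val i)}) (midx_sub sS x i) (a (val i)) =
    \prod_(i in S) F i.
  rewrite (big_sub _ F); apply: eq_bigr => i _.
  by rewrite ffunE -[val i]/(val (incl sS i)) FE.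
transitivity (\prod_(i in A :|: B) F i).
  by rewrite !FS -bigU //; apply: eq_bigl => i; rewrite !inE.
by rewrite (big_sub _ F); apply: eq_bigr => j _; rewrite FE.
Qed.

Lemma tensor_full_pure (K : fieldType) (I : finType) (V : I -> vectType K)
    (a : forall i, V i) :
  tensor_full (pure (fun i => a (val i)) : tensor (V|_setT)) = pure a.
Proof.
apply/ffunP => x; rewrite !ffunE.
pose F i := coord (vbasis {:V i}) (x i) (a i).
under eq_bigr do rewrite ffunE.
by rewrite -(big_sub setT F); apply: eq_bigl => i; rewrite inE.
Qed.

Lemma labels_perfect (L : Type) (lab : nat -> L) (k m : nat) :
  labels (perfect lab k m) = map lab (iota m (2 ^ k)).
Proof.
elim: k m => //= k IH m.
by rewrite !IH -map_cat -iotaD expnS mul2n addnn.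
Qed.

Lemma labels_train_track (L : Type) (lab : nat -> L) (j : nat) :
  labels (train_track lab j) = map lab (iota 0 j.+1).
Proof. by elim: j => // j IH; rewrite -[j.+2]addn1 iotaD map_cat -IH. Qed.

Lemma map_ordlab (n : nat) (n_gt0 : (0 < n)%N) :
  map (ordlab n_gt0) (iota 0 n) = enum 'I_n.
Proof.
apply: (inj_map val_inj); rewrite val_enum_ord -map_comp -[RHS]map_id.
by apply/eq_in_map => m; rewrite mem_iota /= => /modn_small.
Qed.

Lemma perfect_tree_bij (k : nat) : bij_labelled (perfect_tree k).
Proof. by rewrite /bij_labelled labels_perfect map_ordlab. Qed.

Lemma train_track_tree_bij (n : nat) (n_gt0 : (0 < n)%N) :
  bij_labelled (train_track_tree n_gt0).
Proof.
by rewrite /bij_labelled labels_train_track prednK // map_ordlab.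
Qed.

Lemma in_down (I : finType) (v : tree I) (i : I) :
  (i \in down v) = (i \in labels v).
Proof.
by elim: v => [j|v1 IH1 v2 IH2] /=; rewrite !inE // IH1 IH2 mem_cat.
Qed.

Lemma mem_map_ordlab (n : nat) (n_gt0 : (0 < n)%N) (m l : nat) (j : 'I_n) :
  (m + l <= n)%N ->
  (j \in map (ordlab n_gt0) (iota m l)) = (m <= j < m + l)%N.
Proof.
move=> le_n; apply/mapP/idP => [[i]|j_in].
  rewrite mem_iota => /andP[le_i lt_i] ->.
  by rewrite /= modn_small ?le_i // (leq_trans lt_i).
by exists (val j); rewrite ?mem_iota //; apply/val_inj; rewrite /= modn_small.
Qed.

Lemma vertex_perfect (L : Type) (lab : nat -> L) (k q : nat) (v : tree L) :
  vertex (perfect lab k (2 ^ k * q)) v <->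
  exists m i, [/\ (m <= k)%N, (2 ^ (k - m) * q <= i < 2 ^ (k - m) * q.+1)%N
    & v = perfect lab m (2 ^ m * i)].
Proof.
elim: k q => [|k IH] q.
  split=> [[->|//]|[m [i [+ + ->]]]].
    by exists 0%N, q; rewrite subnn expn0 !mul1n !leqnn.
  by rewrite leqn0 => /eqP->; rewrite subnn expn0 !mul1n ltnS => /anti_leq->; left.
have E1 : (2 ^ k.+1 * q = 2 ^ k * q.*2)%N by rewrite expnS; lia.
have E2 : (2 ^ k.+1 * q + 2 ^ k = 2 ^ k * q.*2.+1)%N by rewrite expnS; lia.
have TE : perfect lab k.+1 (2 ^ k.+1 * q) =
    Node (perfect lab k (2 ^ k * q.*2)) (perfect lab k (2 ^ k * q.*2.+1)).
  by rewrite -E1 -E2.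
have sub m : (m <= k)%N -> (2 ^ (k.+1 - m) = 2 * 2 ^ (k - m))%N.
  by move=> le_mk; rewrite subSn // expnS.
rewrite TE /= !IH; split.
  case=> [->|[]].
  - by exists k.+1, q; rewrite subnn expn0 !mul1n !leqnn TE.
  - case=> m [i [le_mk i_in ->]]; exists m, i; split=> //; first exact: leqW.
    by rewrite sub //; nia.
  - case=> m [i [le_mk i_in ->]]; exists m, i; split=> //; first exact: leqW.
    by rewrite sub //; nia.
case=> m [i [+ + ->]]; rewrite leq_eqVlt ltnS => /orP[/eqP->|le_mk].
  by rewrite subnn expn0 !mul1n ltnS => /anti_leq<-; left; rewrite TE.
rewrite sub // => i_in; right.
case: (ltnP i (2 ^ (k - m) * q.*2.+1)) => i_q; [left|right];
  by exists m, i; split=> //; nia.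
Qed.

Lemma down_perfect_tree (k : nat) (S : {set 'I_(2 ^ k)}) :
  (exists2 v, vertex (perfect_tree k) v & down v = S) <->
  exists m i, [/\ (m <= k)%N, (i < 2 ^ (k - m))%N
    & S = [set j : 'I_(2 ^ k) | (2 ^ m * i <= j < 2 ^ m * i.+1)%N]].
Proof.
have downE m i : (m <= k)%N -> (i < 2 ^ (k - m))%N ->
    down (perfect (ordlab (pow2_gt0 k)) m (2 ^ m * i)) =
    [set j : 'I_(2 ^ k) | (2 ^ m * i <= j < 2 ^ m * i.+1)%N].
  move=> le_mk lt_i; apply/setP => j; rewrite in_down labels_perfect inE.
  rewrite mem_map_ordlab -mulnSr //.
  by rewrite -[X in (_ <= 2 ^ X)%N](subnKC le_mk) expnD leq_mul2l lt_i orbT.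
have := @vertex_perfect _ (ordlab (pow2_gt0 k)) k 0; rewrite muln0 => vP.
split=> [[v /vP[m [i []]]]|[m [i [le_mk lt_i ->]]]].
  by rewrite muln0 muln1 /= => le_mk lt_i -> <-; exists m, i; rewrite downE.
exists (perfect (ordlab (pow2_gt0 k)) m (2 ^ m * i)); last exact: downE.
by apply/vP; exists m, i; rewrite muln0 muln1.
Qed.

Lemma vertex_train_track (L : Type) (lab : nat -> L) (j : nat) (v : tree L) :
  vertex (train_track lab j) v <->
  (exists2 i, (i <= j)%N & v = Leaf (lab i)) \/
  (exists2 i, (0 < i <= j)%N & v = train_track lab i).
Proof.
elim: j => [|j IH] /=.
  split=> [[->|//]|[[i]|[i]]]; first by left; exists 0%N.
    by rewrite leqn0 => /eqP-> ->; left.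
  by case: i.
rewrite IH; split.
  case=> [->|[[[i le_ij ->]|[i /andP[? le_ij] ->]]|[->|//]]].
  - by right; exists j.+1; rewrite ?leqnn.
  - by left; exists i => //; exact: leqW.
  - by right; exists i => //; rewrite leqW ?andbT.
  - by left; exists j.+1.
case=> [[i + ->]|[i /andP[i_gt0 +] ->]]; rewrite leq_eqVlt ltnS.
  by case/orP=> [/eqP->|le_ij]; right; [right; left|left; left; exists i].
case/orP=> [/eqP->|le_ij]; [by left|right; left; right].
by exists i; rewrite ?i_gt0.
Qed.

Lemma down_train_track_tree (n : nat) (n_gt0 : (0 < n)%N) (S : {set 'I_n}) :
  (exists2 v, vertex (train_track_tree n_gt0) v & down v = S) <->
  (exists j, S = [set j])
  \/ exists2 j, (2 <= j <= n)%N & S = [set i : 'I_n | (i < j)%N].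
Proof.
have downE j : (j < n)%N ->
    down (train_track (ordlab n_gt0) j) = [set i : 'I_n | (i < j.+1)%N].
  move=> lt_jn; apply/setP => i.
  by rewrite in_down labels_train_track inE mem_map_ordlab.
split=> [[v /vertex_train_track[[i _ ->]|[i /andP[i_gt0 le_i] ->]] <-]|].
- by left; exists (ordlab n_gt0 i).
- have lt_in : (i < n)%N by rewrite -(prednK n_gt0).
  by right; exists i.+1; rewrite ?downE ?ltnS ?i_gt0.
case=> [[j ->]|[[|j]// /andP[j_gt0 lt_jn] ->]].
  exists (Leaf j) => //; apply/vertex_train_track; left; exists (val j).
    by rewrite -ltnS prednK // ltn_ord.
  by congr Leaf; apply/val_inj; rewrite /= modn_small.
exists (train_track (ordlab n_gt0) j); last exact: downE.
by apply/vertex_train_track; right; exists j => //; apply/andP; split=> //;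
  rewrite -ltnS prednK.
Qed.

(* Main.v *)
Require Import Defs.
From mathcomp Require Import all_boot all_algebra.
From mathcomp Require Import zify.

(** The rank of the flattening of a tensor [t] along a set [S] of factors bounds
    the dimension of the space spanned by the slices of [t] in the directions of
    [S], and these spaces of slices, one for each vertex of a tree, form a
    tensor network containing [t]. So it suffices to bound the flattening ranks
    of [t] in [HF r k] along initial segments. Going down the perfect tree
    towards the point where the segment is cut, the segment and its complement
    are together the union of at most [k + 1] sets [down v], hence one of them
    is the union of at most [uphalf k] such sets; each contributes a factor at
    most [r] to the rank, and the rank is the same on both sides of the cut. *)

Set Implicit Arguments.
Unset Strict Implicit.
Unset Printing Implicit Defensive.

Import GRing.Theory.
Local Open Scope ring_scope.

(** * Slice spaces of a tensor and the network they form *)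

Section Slices.
Variables (K : fieldType) (I : finType) (V : I -> vectType K).
Implicit Types (A B S : {set I}) (t : tensor V) (x y : midx V).

Definition depends_on S (f : midx V -> K) :=
  forall x y, (forall i, i \in S -> x i = y i) -> f x = f y.

(** [decP] provides the proof of [i \in S] that an index of [x] requires. *)
Definition glue S (x : midx (V|_S)) y : midx V :=
  [ffun i => match decP (@idP (i \in S)) with
             | left iS => x (exist _ i iS)
             | right _ => y i
             end].

Lemma glue_in S (x : midx (V|_S)) y (i : {i | i \in S}) :
  glue x y (val i) = x i.
Proof.
case: i => i iS; rewrite ffunE /=.
by case: decP => // iS'; rewrite (bool_irrelevance iS' iS).
Qed.

Lemma glue_out S (x : midx (V|_S)) y (i : I) :
  i \notin S -> glue x y i = y i.
Proof. by rewrite ffunE; case: decP => // iS /negP. Qed.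

Lemma midx_subE A B (sAB : A \subset B) x :
  midx_sub sAB (midx_res B x) = midx_res A x.
Proof. by apply/ffunP => i; rewrite !ffunE. Qed.

Lemma tmulE A B (u : tensor (V|_A)) (w : tensor (V|_B)) x :
  tmul u w (midx_res (A :|: B) x) = u (midx_res A x) * w (midx_res B x).
Proof. by rewrite ffunE !midx_subE. Qed.

Lemma glue_sub A B (sAB : A \subset B) (x : midx (V|_B)) y
    (i : {i | i \in A}) :
  midx_sub sAB x i = glue x y (val i).
Proof. by rewrite [LHS]ffunE -(glue_in x y). Qed.

Definition slice S t y : tensor (V|_S) := [ffun x => t (glue x y)].

(** The image of the flattening of [t] along [S]. Letting [y] range over all of [midx V] may repeat
    slices, which is harmless for a span. *)
Definition slices S t : {vspace tensor (V|_S)} :=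
  (\sum_(y : midx V) <[slice S t y]>)%VS.

Lemma mem_slice S t y : slice S t y \in slices S t.
Proof. by rewrite memvE; apply: (sumv_sup y). Qed.

(** Once the coordinates outside [S] are fixed, each [h j] is a scalar, so every slice is a
    combination of the [g j] read as tensors over [S]. *)
Lemma dim_slices S t (J : finType) (g h : J -> midx V -> K) :
    (forall j, depends_on S (g j)) -> (forall j, depends_on (~: S) (h j)) ->
    (forall x, t x = \sum_j g j x * h j x) ->
  (\dim (slices S t) <= #|J|)%N.
Proof.
move=> gS hS tE.
(* [midx V] is empty when some [V i] is zero; the sum of lines is then empty. *)
have [y0 _|noy] := pickP (midx V); last first.
  by rewrite /slices big1 ?dimv0 // => y; have := noy y.
pose G j : tensor (V|_S) := [ffun x => g j (glue x y0)].
have sG : (slices S t <= <<[seq G j | j <- enum J]>>)%VS.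
  apply/subv_sumP => y _; rewrite -memvE.
  have -> : slice S t y = \sum_j h j y *: G j.
    apply/ffunP => x; rewrite ffunE tE sum_ffunE; apply: eq_bigr => j _.
    rewrite !ffunE mulrC; congr (_ * _).
      by apply: hS => i; rewrite inE; exact: glue_out.
    apply: gS => i iS.
    by rewrite -[i]/(val (exist (fun i => i \in S) i iS)) !glue_in.
  apply: memv_suml => j _; apply: memvZ; apply: memv_span.
  by apply: map_f; rewrite mem_enum.
apply: leq_trans (dimvS sG) _; apply: leq_trans (dim_span _) _.
by rewrite size_map -cardE.
Qed.

Lemma tmul_tmulv A B (U : {vspace tensor (V|_A)}) (W : {vspace tensor (V|_B)})
    u w :
  u \in U -> w \in W -> tmul u w \in tmulv U W.
Proof.
move=> uU wW.
have -> : tmul u w = \sum_i \sum_j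
    (coord (vbasis U) i u * coord (vbasis W) j w) *:
      tmul (vbasis U)`_i (vbasis W)`_j.
  apply/ffunP => x.
  rewrite ffunE {1}(coord_vbasis uU) {1}(coord_vbasis wW) !sum_ffunE mulr_suml.
  apply: eq_bigr => i _; rewrite mulr_sumr sum_ffunE.
  by apply: eq_bigr => j _; rewrite !ffunE mulrACA.
apply: memv_suml => i _; apply: memv_suml => j _; apply: memvZ.
by apply: memv_span; apply: allpairs_f; rewrite mem_nth ?size_tuple.
Qed.

(** An [A :|: B]-slice with its [B]-coordinates fixed is an [A]-slice; its coefficients in a basis
    of [slices A t], as functions of the [B]-coordinates, lie in [slices B t]. *)
Lemma slices_tmulv A B t : [disjoint A & B] ->
  (slices (A :|: B) t <= tmulv (slices A t) (slices B t))%VS.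
Proof.
move=> disAB; apply/subv_sumP => y _; rewrite -memvE.
pose X := vbasis (slices A t).
pose delta (x' : midx (V|_A)) : tensor (V|_A) := [ffun x => (x == x')%:R].
(* The functional [coord X i] contracts the [A]-factors of [t], and a
   contraction of [t] is a combination of its [B]-slices. *)
pose w i := \sum_x' coord X i (delta x') *: slice B t (glue x' y).
have -> : slice (A :|: B) t y = \sum_(i < \dim (slices A t)) tmul X`_i (w i).
  apply/ffunP => x; rewrite sum_ffunE.
  set yx := glue x y.
  have -> : slice (A :|: B) t y x = slice A t yx (midx_sub (subsetUl A B) x).
    rewrite !ffunE; congr (t _); apply/ffunP => i.
    have [iA|iA] := boolP (i \in A); last by rewrite [RHS]glue_out.
    rewrite -[i]/(val (exist (fun i => i \in A) i iA)) [RHS]glue_in.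
    exact/esym/glue_sub.
  rewrite {1}(coord_vbasis (mem_slice A t yx)) sum_ffunE.
  apply: eq_bigr => i _; rewrite !ffunE mulrC; congr (_ * _).
  have {1}-> : slice A t yx = \sum_x' slice A t yx x' *: delta x'.
    apply/ffunP => x'; rewrite sum_ffunE (bigD1 x') //= big1 => [|x'' neq].
      by rewrite !ffunE eqxx addr0 [RHS]mulr1.
    by rewrite !ffunE eq_sym (negbTE neq); exact: mulr0.
  rewrite linear_sum sum_ffunE; apply: eq_bigr => x' _.
  (* Both sides evaluate [t] with [A]-entries from [x'], [B]-entries from [x] and the others from
     [y]; disjointness makes the order of gluing immaterial. *)
  rewrite linearZ !ffunE [LHS]mulrC; congr (_ * t _); apply/ffunP => j.
  have [jB|jB] := boolP (j \in B).
    have jA : j \notin A by rewrite (disjointFl disAB).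
    rewrite -[j]/(val (exist (fun i => i \in B) j jB)) [RHS]glue_in.
    by rewrite glue_out // (glue_sub _ _ y).
  rewrite (glue_out _ _ jB).
  have [jA|jA] := boolP (j \in A).
    by rewrite -[j]/(val (exist (fun i => i \in A) j jA)) !glue_in.
  by rewrite !glue_out // inE negb_or jA.
apply: memv_suml => i _; apply: tmul_tmulv.
  by rewrite vbasis_mem // mem_nth ?size_tuple.
by apply: memv_suml => x' _; apply: memvZ; exact: mem_slice.
Qed.

Lemma uniq_cat_disjoint (T1 T2 : tree I) :
  uniq (labels T1 ++ labels T2) -> [disjoint down T1 & down T2].
Proof.
rewrite cat_uniq => /and3P[_ /hasPn T12 _].
rewrite disjoint_sym; apply/pred0P => i /=; rewrite !in_down.
by apply/negbTE/negP => /andP[/T12/= /negP].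
Qed.

Lemma vertex_uniq (T v : tree I) :
  uniq (labels T) -> vertex T v -> uniq (labels v).
Proof.
elim: T => [i|T1 IH1 T2 IH2] uT /=; first by case=> [->|].
move: (uT) => /=; rewrite cat_uniq => /and3P[u1 _ u2].
by case=> [->|[/IH1|/IH2]] //; apply.
Qed.

(** Distinct labels give the disjointness required at each node; at the root no coordinate is left
    to fix, so a slice is [t] itself. *)
Lemma TNS_slices (T : tree I) (f : tree I -> nat) t :
    uniq (labels T) -> down T = setT ->
    (forall v, vertex T v -> (\dim (slices (down v) t) <= f v)%N) ->
  TNS T f t.
Proof.
move=> uT dT dim_le; exists (fun v => slices (down v) t); split=> //.
  by move=> v1 v2 /(vertex_uniq uT) u12; apply/slices_tmulv/uniq_cat_disjoint.
have [y _|noy] := pickP (midx V); last first.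
  by exists 0; [exact: mem0v|apply/ffunP => x; have := noy x].
exists (slice (down T) t y); first exact: mem_slice.
apply/ffunP => x; rewrite !ffunE; congr (t _); apply/ffunP => i.
have iT : i \in down T by rewrite dT inE.
by rewrite -[i]/(val (exist (fun i => i \in down T) i iT)) glue_in ffunE.
Qed.

End Slices.

(** * Flattening ranks of the tensors in a network *)

Section Flattening.
Variables (K : fieldType) (I : finType) (V : I -> vectType K) (r : nat).
Variable U : forall v : tree I, {vspace tensor (V|_(down v))}.
Implicit Types (A S : {set I}) (T v : tree I).

(** The root membership condition of [TNS] is left out, so that the property passes to subtrees. *)
Definition network T :=
  (forall v, vertex T v -> (\dim (U v) <= r)%N) /\
  (forall v1 v2, vertex T (Node v1 v2) ->
     (U (Node v1 v2) <= tmulv (U v1) (U v2))%VS).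

Lemma vertex_root T : vertex T T.
Proof. by case: T => *; left. Qed.

Lemma network_Node T1 T2 : network (Node T1 T2) ->
  [/\ network T1, network T2 & (U (Node T1 T2) <= tmulv (U T1) (U T2))%VS].
Proof.
case=> dimU subU; split; last by apply: subU; left.
- by split=> *; [apply: dimU|apply: subU]; right; left.
- by split=> *; [apply: dimU|apply: subU]; right; right.
Qed.

(** Membership in the module spanned by the [g j] over the functions of the coordinates outside [S];
    full multi-indices give tensors over different [A] a common domain. *)
Definition generated S (J : finType) (g : J -> midx V -> K) A
    (u : tensor (V|_A)) :=
  exists2 h : J -> midx V -> K, forall j, depends_on (~: S) (h j)
    & forall x, u (midx_res A x) = \sum_j g j x * h j x.

Lemma generated_span S J g A (X : seq (tensor (V|_A))) u :
  (forall w, w \in X -> @generated S J g A w) -> u \in <<X>>%VS ->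
  generated S g u.
Proof.
move=> genX /(coord_span (X := in_tuple X)) ->.
elim/big_ind: _ => [|v w [h hS vE] [h' h'S wE]|i _].
- exists (fun _ _ => 0) => // x.
  by rewrite big1 => [|j _]; rewrite ?ffunE ?mulr0.
- exists (fun j x => h j x + h' j x) => [j x y xy|x].
    by rewrite (hS j _ _ xy) (h'S j _ _ xy).
  by rewrite ffunE vE wE -big_split; apply: eq_bigr => j _; rewrite mulrDr.
have [h hS wE] := genX _ (mem_nth 0 (ltn_ord i)).
set c := coord _ _ _; exists (fun j x => c * h j x) => [j x y xy|x].
  by rewrite (hS j _ _ xy).
rewrite ffunE wE; rewrite [LHS]mulr_sumr.
by apply: eq_bigr => j _; rewrite mulrCA.
Qed.

(* The [g j] are common to all the elements of [U T]: this is what makes the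
   exponents additive in [flat_le_Node]. *)
Definition flat_le S (a : nat) T :=
  exists (J : finType) (g : J -> midx V -> K),
  [/\ (#|J| <= r ^ a)%N, forall j, depends_on S (g j)
    & forall u, u \in U T -> generated S g u].

Lemma flat_le_mono S a b T :
  (0 < r)%N -> (a <= b)%N -> flat_le S a T -> flat_le S b T.
Proof.
move=> r_gt0 le_ab [J [g [cJ gS gen]]]; exists J, g; split=> //.
by apply: leq_trans cJ _; rewrite leq_pexp2l.
Qed.

Lemma depends_on_res S A (u : tensor (V|_A)) :
  A \subset S -> depends_on S (fun x => u (midx_res A x)).
Proof.
move=> sAS x y xy; congr (u _); apply/ffunP => i; rewrite !ffunE.
by apply: xy; apply: (subsetP sAS); exact: valP.
Qed.

Lemma flat_le_inside S T :
  network T -> down T \subset S -> flat_le S 1 T.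
Proof.
move=> [dimU _] sTS; exists 'I_(\dim (U T)).
exists (fun (j : 'I_(_)) x => (vbasis (U T))`_j (midx_res (down T) x)); split.
- by rewrite card_ord expn1; apply: dimU; exact: vertex_root.
- by move=> j; exact: depends_on_res.
move=> u uU; exists (fun j _ => coord (vbasis (U T)) j u) => // x.
rewrite {1}(coord_vbasis uU) sum_ffunE; apply: eq_bigr => j _.
by rewrite ffunE mulrC.
Qed.

(** With [1] as the only generator, the tensor itself is the coefficient. *)
Lemma flat_le_outside S T :
  down T \subset ~: S -> flat_le S 0 T.
Proof.
move=> sTS; exists unit, (fun _ _ => 1); split=> //.
  by rewrite card_unit.
move=> u uU; exists (fun _ x => u (midx_res (down T) x)) => [_|x].
  exact: depends_on_res.
by rewrite (big_pred1 tt) ?mul1r //; case.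
Qed.

Lemma flat_le_Node S a b T1 T2 :
  (U (Node T1 T2) <= tmulv (U T1) (U T2))%VS ->
  flat_le S a T1 -> flat_le S b T2 -> flat_le S (a + b) (Node T1 T2).
Proof.
move=> /subvP subU [J1 [g1 [c1 g1S gen1]]] [J2 [g2 [c2 g2S gen2]]].
exists (J1 * J2)%type, (fun j x => g1 j.1 x * g2 j.2 x); split.
- by rewrite card_prod expnD leq_mul.
- by move=> j x y xy; rewrite (g1S j.1 _ _ xy) (g2S j.2 _ _ xy).
move=> u /subU; apply: generated_span => _ /allpairsP[[v w] /= [vU wU ->]].
have [h1 h1S vE] := gen1 v (vbasis_mem vU).
have [h2 h2S wE] := gen2 w (vbasis_mem wU).
exists (fun j x => h1 j.1 x * h2 j.2 x) => [j x y xy|x].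
  by rewrite (h1S j.1 _ _ xy) (h2S j.2 _ _ xy).
rewrite tmulE vE wE big_distrlr pair_bigA.
by apply: eq_bigr => -[j1 j2] _; rewrite /= mulrACA.
Qed.

(** The exponent is a boolean read as a number: only a leaf labelled [i] costs a factor, and
    distinct labels confine it to one subtree. *)
Lemma flat_le_set1 (i : I) T :
  network T -> uniq (labels T) -> flat_le [set i] (i \in down T) T.
Proof.
elim: T => [j|T1 IH1 T2 IH2] netT uT.
  have [/set1P ij|ij] := boolP (i \in down (Leaf j)).
    by apply: flat_le_inside => //=; rewrite ij.
  by apply: flat_le_outside; rewrite /= sub1set !inE eq_sym -in_set1.
have [net1 net2 sub12] := network_Node netT.
have dis := uniq_cat_disjoint uT.
have -> : (i \in down (Node T1 T2)) =
    ((i \in down T1) + (i \in down T2))%N :> nat.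
  rewrite inE; case: (boolP (i \in down T1)) => //= i1.
  by rewrite (disjointFr dis).
move: uT => /=; rewrite cat_uniq => /and3P[u1 _ u2].
by apply: flat_le_Node; [|apply: IH1|apply: IH2].
Qed.

(** Row rank equals column rank: for [~: S] the [g j] and [h j] exchange roles. *)
Lemma dim_slices_flat_le S a T (u : tensor (V|_(down T))) :
    u \in U T -> flat_le S a T \/ flat_le (~: S) a T ->
  (\dim (slices S (tensor_full u)) <= r ^ a)%N.
Proof.
move=> uU [] [J [g [cJ gS gen]]]; have [h hS uE] := gen u uU;
  apply: leq_trans cJ.
  by apply: (dim_slices gS hS) => x; rewrite ffunE uE.
rewrite setCK in hS; apply: (dim_slices hS gS) => x.
by rewrite ffunE uE; apply: eq_bigr => j _; rewrite mulrC.
Qed.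

End Flattening.

(** * Initial segments in the perfect tree *)

(** The cut at [c] crosses at most one half of the tree; the other half lies on one side and adds at
    most 1 to [a + b], starting from 1 at a leaf. *)
Lemma flat_le_perfect (K : fieldType) (n : nat) (n_gt0 : (0 < n)%N)
    (V : 'I_n -> vectType K) (r : nat)
    (U : forall v : tree 'I_n, {vspace tensor (V|_(down v))}) (c m o : nat) :
  let T := perfect (ordlab n_gt0) m o in
  let S := [set i : 'I_n | (i < c)%N] in
  (o + 2 ^ m <= n)%N -> network r U T ->
  exists a b, [/\ (a + b <= m.+1)%N, flat_le r U S a T
    & flat_le r U (~: S) b T].
Proof.
move=> T S; rewrite {}/T.
have inT m' o' (i : 'I_n) : (o' + 2 ^ m' <= n)%N ->
    (i \in down (perfect (ordlab n_gt0) m' o')) = (o' <= i < o' + 2 ^ m')%N.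
  by move=> le_n; rewrite in_down labels_perfect mem_map_ordlab.
have one_side m' o' : (o' + 2 ^ m' <= n)%N ->
    network r U (perfect (ordlab n_gt0) m' o') ->
    (o' + 2 ^ m' <= c)%N || (c <= o')%N ->
    exists a b, [/\ (a + b <= 1)%N,
      flat_le r U S a (perfect (ordlab n_gt0) m' o')
    & flat_le r U (~: S) b (perfect (ordlab n_gt0) m' o')].
  move=> le_n net /orP[le_c|c_le].
    have sTS : down (perfect (ordlab n_gt0) m' o') \subset S.
      by apply/subsetP => i; rewrite inT // inE => /andP[_ /leq_trans]; apply.
    exists 1%N, 0%N; split=> //; first exact: flat_le_inside.
    by apply: flat_le_outside; rewrite setCK.
  have sTS : down (perfect (ordlab n_gt0) m' o') \subset ~: S.
    apply/subsetP => i; rewrite inT // !inE -leqNgt => /andP[le_i _].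
    exact: leq_trans le_i.
  exists 0%N, 1%N; split=> //; first exact: flat_le_outside.
  exact: flat_le_inside.
elim: m o => [|m IH] o le_n net.
  by apply: one_side => //; rewrite expn0 addn1; case: ltnP.
have le_n1 : (o + 2 ^ m <= n)%N by move: le_n; rewrite expnS; lia.
have le_n2 : (o + 2 ^ m + 2 ^ m <= n)%N by move: le_n; rewrite expnS; lia.
have [net1 net2 sub12] := network_Node net.
(* Exponents are regrouped by side of the cut, since [flat_le_Node] adds those of the two halves for
   one fixed set. *)
suff [a1 [b1 [a2 [b2 [le_m [A1 B1] [A2 B2]]]]]] :
    exists a1 b1 a2 b2, [/\ (a1 + a2 + (b1 + b2) <= m.+2)%N,
      flat_le r U S a1 (perfect (ordlab n_gt0) m o)
        /\ flat_le r U (~: S) b1 (perfect (ordlab n_gt0) m o)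
    & flat_le r U S a2 (perfect (ordlab n_gt0) m (o + 2 ^ m))
        /\ flat_le r U (~: S) b2 (perfect (ordlab n_gt0) m (o + 2 ^ m))].
  by exists (a1 + a2)%N, (b1 + b2)%N; split=> //; exact: flat_le_Node.
have [le_c|lt_c] := leqP (o + 2 ^ m) c.
  have [|a1 [b1 [le1 A1 B1]]] := one_side m o le_n1 net1; first by rewrite le_c.
  have [a2 [b2 [le2 A2 B2]]] := IH _ le_n2 net2.
  by exists a1, b1, a2, b2; split=> //; lia.
have [|a2 [b2 [le2 A2 B2]]] := one_side m _ le_n2 net2.
  by rewrite (ltnW lt_c) orbT.
have [a1 [b1 [le1 A1 B1]]] := IH _ le_n1 net1.
by exists a1, b1, a2, b2; split=> //; lia.
Qed.

Theorem proposition1p3 (K : fieldType) (r k : nat)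
    (V : 'I_(2 ^ k) -> vectType K) :
  (1 <= r)%N -> (1 <= k)%N ->
  (forall i : 'I_(2 ^ k), (r <= \dim {:V i})%N) ->
  forall t : tensor V,
    HF r k t -> TT (r ^ uphalf k) (2 ^ k) (pow2_gt0 k) t.
Proof.
move=> r_gt0 k_gt0 _ t [U [dimU subU [u uU ->]]].
have net : network r U (perfect_tree k) by [].
have uniqT (T : tree 'I_(2 ^ k)) : bij_labelled T -> uniq (labels T).
  by move=> /perm_uniq->; exact: enum_uniq.
have bijTT := train_track_tree_bij (pow2_gt0 k).
apply: TNS_slices => [||v vT]; first exact: uniqT.
  by apply/setP => i; rewrite in_setT in_down (perm_mem bijTT) mem_enum.
have [[j ->]|[j _ ->]] : (exists j, down v = [set j]) \/
    (exists2 j, (2 <= j <= 2 ^ k)%N &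
      down v = [set i : 'I_(2 ^ k) | (i < j)%N]).
- by apply/(down_train_track_tree (pow2_gt0 k)); exists v.
- have fl := flat_le_set1 j net (uniqT _ (perfect_tree_bij k)).
  apply: (dim_slices_flat_le uU); left; apply: flat_le_mono fl => //.
  by apply: leq_trans (leq_b1 _) _; lia.
have [//|a [b [le_ab A B]]] :=
  @flat_le_perfect K _ (pow2_gt0 k) V r U j k 0 _ net.
apply: (dim_slices_flat_le uU).
(* If both exceeded [uphalf k], then [a + b] would be at least [k + 2]. *)
have [le_a|le_b] : (a <= uphalf k)%N \/ (b <= uphalf k)%N by lia.
  by left; exact: flat_le_mono A.
by right; exact: flat_le_mono B.
Qed.
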